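(* Let $g$ be a connected social network on $N=\{1,\dots,n\}$ that is bipartite with two (nonempty) sets of nodes $A$ and $B$, and let $h$ be its comparison network. Then there exists a mechanism supporting the comparison network $h$ on its two components $A$ and $B$.
   Context: Setting. $N=\{1,\dots,n\}$ is a set of individuals and $g$ is a connected, undirected simple graph on $N$; $g_{ij}=1$ if $i,j$ are linked (friends), $g_{ij}=0$ otherwise. $g$ is bipartite with sets $A,B$ if $N$ is the disjoint union of $A$ and $B$ and every link joins an individual of $A$ to one of $B$. Each individual $i$ has a real characteristic $\theta_i$; a realization is a vector $(\theta_1,\dots,\theta_n)$ with pairwise distinct entries. Individual $i$ observes the ordinal comparison between distinct $j,k$ if and only if each of $j,k$ is either $i$ or a friend of $i$. Comparison network. $h$ is the undirected graph on $N$ with, for distinct $i,j$, $h_{ij}=1$ if and only if there is $k$ with $g_{ik}g_{jk}=1$. (For $g$ connected and bipartite with sets $A,B$, the components of $h$ have vertex sets $A$ and $B$.) Types. Individual $i$'s type is a matrix $T^i=[t^i_{jk}]$ with entries in $\{-1,0,1\}$, $t^i_{jk}=-t^i_{kj}$, nonzero if and only if $i$ observes the comparison between $j$ and $k$; $t^i_{jk}=1$ means $\theta_j>\theta_k$, $t^i_{jk}=-1$ means $\theta_j<\theta_k$. $T^i_h$ is the restriction of $T^i$ to pairs $(j,k)$ that are linked in $h$ (entries for pairs not linked in $h$ are set to $0$; all information about such pairs is discarded). Any matrix with the entry pattern of $T^i_h$ may be reported by $i$. A vector of (true) restricted types is a profile ${\bf T}_h=(T^1_h,\dots,T^n_h)$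 generated by some realization. Write $i\succ_{{\bf T}_h} j$ if $i$ and $j$ are joined by a finite sequence $i=i^0,\dots,i^M=j$ ($M\ge1$) such that for each $m=0,\dots,M-1$ some individual's matrix in ${\bf T}_h$ has entry $1$ at $(i^m,i^{m+1})$. Supporting $h$. Consider a direct mechanism assigning to every vector of reported restricted matrices a complete ranking $\rho$ of $N$, i.e. a bijection $i\mapsto\rho_i\in\{1,\dots,n\}$; individuals care only about their own rank and strictly prefer higher $\rho_i$. It supports $h$ if it satisfies (i) ex post incentive compatibility: for every individual $i$, every vector of restricted types ${\bf T}_h=(T^i_h,T^{-i}_h)$ and every report $T'^i_h$ of $i$, $\rho_i({\bf T}_h)\ge\rho_i(T'^i_h,T^{-i}_h)$; and (ii) ex post efficiency on $h$: for every vector of restricted types ${\bf T}_h$ and every pair $(i,j)$ with $h_{ij}=1$, $i\succ_{{\bf T}_h} j$ implies $\rho_i({\bf T}_h)>\rho_j({\bf T}_h)$. Rankings of pairs not linked in $h$ are otherwise unconstrained. *)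

(* Defs.v *)
From mathcomp Require Import all_boot all_order all_algebra all_fingroup.
From mathcomp Require Import reals.

Set Implicit Arguments.
Unset Strict Implicit.
Unset Printing Implicit Defensive.

Import Order.TTheory GRing.Theory Num.Theory.
Local Open Scope ring_scope.

Section Definitions.
Variable n : nat.
Implicit Types (g h : rel 'I_n) (A B : {set 'I_n}) (i j k : 'I_n).

Definition simple_graph g := symmetric g /\ irreflexive g.

Definition connected_graph g := forall i j, connect g i j.

Definition bipartite g A B :=
  [/\ A :|: B = [set: 'I_n],
      [disjoint A & B]
    & forall i j, g i j ->
        (i \in A) && (j \in B) || (i \in B) && (j \in A)].

Definition comparison_network g : rel 'I_n :=
  fun i j => (i != j) && [exists k, g i k && g j k].

Definition observes g i j k : bool :=
  [&& j != k, (j == i) || g i j & (k == i) || g i k].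

Definition type_of (R : realType) g (theta : 'I_n -> R) i : 'M[int]_n :=
  \matrix_(j, k) if observes g i j k then sgz (theta j - theta k) else 0.

Definition restrict h (M : 'M[int]_n) : 'M[int]_n :=
  \matrix_(j, k) if h j k then M j k else 0.

(* The entry pattern of [restrict (comparison_network g) (type_of g theta i)].
   Transitivity is not required, so a report need not be rationalized by any
   realization. *)
Definition is_report g i (M : 'M[int]_n) : bool :=
  [forall j, forall k,
    [&& M j k \in [:: -1; 0; 1],
        M j k == - M k j
      & (M j k != 0) == observes g i j k && comparison_network g j k]].

Definition report g i : Type := {M : 'M[int]_n | is_report g i M}.

Definition profile g : Type := forall i, report g i.

Definition generated_by (R : realType) g (theta : 'I_n -> R)
    (T : profile g) : Prop :=
  forall i, val (T i) = restrict (comparison_network g) (type_of g theta i).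

(* The individuals' true matrices, for a single realization with pairwise
   distinct characteristics; a profile of reports need not satisfy this. *)
Definition restricted_types (R : realType) g (T : profile g) : Prop :=
  exists2 theta : 'I_n -> R, injective theta & generated_by theta T.

Definition revealed g (T : profile g) : rel 'I_n :=
  fun i j => [exists k, val (T k) i j == 1].

(* [i :: p] is the sequence i^0, ..., i^M with M = size p >= 1. *)
Definition succ g (T : profile g) i j : Prop :=
  exists p : seq 'I_n, [/\ (0 < size p)%N, path (revealed T) i p & last i p = j].

(* Ranks are numbered 0, ..., n - 1 instead of 1, ..., n; a larger value is a
   better rank. *)
Definition mechanism g : Type := profile g -> {perm 'I_n}.

(* [dfwith T r] is [T] with the report of [i] replaced by [r]. *)
Definition ex_post_IC (R : realType) g (rho : mechanism g) : Prop :=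
  forall i (T : profile g) (r : report g i),
    restricted_types R T -> (rho (dfwith T r) i <= rho T i)%N.

Definition ex_post_efficient (R : realType) g (rho : mechanism g) : Prop :=
  forall (T : profile g) i j,
    restricted_types R T -> comparison_network g i j ->
    succ T i j -> (rho T j < rho T i)%N.

Definition supports_comparison_network (R : realType) g (rho : mechanism g) :
    Prop :=
  ex_post_IC R rho /\ ex_post_efficient R rho.

Lemma is_report_restricted_type (R : realType) g (theta : 'I_n -> R) i :
  injective theta ->
  is_report g i (restrict (comparison_network g) (type_of g theta i)).
Proof.
move=> inj; apply/forallP=> j; apply/forallP=> k; rewrite !mxE.
have obsC : observes g i k j = observes g i j k.
  by rewrite /observes eq_sym [X in _ && X]andbC.
have hC : comparison_network g k j = comparison_network g j k.
  rewrite /comparison_network eq_sym; congr (_ && _).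
  by apply: eq_existsb => l; rewrite andbC.
rewrite obsC hC.
case: (comparison_network g j k); last by rewrite oppr0 eqxx !inE eqxx orbT andbF.
case Ho: (observes g i j k); last by rewrite oppr0 !inE !eqxx orbT.
have jk : theta j - theta k != 0.
  by rewrite subr_eq0 (inj_eq inj); case/andP: Ho.
rewrite -[theta k - _]opprB sgzN opprK eqxx sgz_eq0 jk eqxx !andbT /=.
by case: (sgzP (theta j - theta k)) jk.
Qed.

End Definitions.

(* Main.v *)
(** Since [g] is bipartite, every pair linked in [h] lies on one side and can be
    compared only by individuals of the other side.  Put one side entirely
    above the other, and order each side by the number of individuals reachable
    through revealed comparisons.  An individual's own report concerns only the
    opposite side, so it affects neither the position of the individual's own
    side nor the order within it.  For a profile generated by a realization the
    revealed relation is acyclic, so being revealed better strictly enlarges the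
    set of reachable individuals. *)
Require Import Defs.
From mathcomp Require Import all_boot all_order all_algebra all_fingroup.
From mathcomp Require Import reals.

Import Order.TTheory GRing.Theory Num.Theory.

Section RankBy.
Context {d : Order.disp_t} {K : orderType d} {n : nat} (key : 'I_n -> K).

Lemma card_below_lt i : (#|[set j | (key j < key i)%O]| < n)%N.
Proof.
rewrite -[X in (_ < X)%N](card_ord n) -cardsT proper_card //.
by apply/properP; split; [exact: subsetT | exists i; rewrite ?inE ?ltxx].
Qed.

Definition rank_by i : 'I_n := Ordinal (card_below_lt i).

Lemma rank_by_lt {i j} : (key i < key j)%O -> (rank_by i < rank_by j)%N.
Proof.
move=> ij; apply/proper_card/properP; split; last by exists i; rewrite !inE ?ltxx.
by apply/subsetP=> k; rewrite !inE => /lt_trans; apply.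
Qed.

Lemma rank_by_inj : injective key -> injective rank_by.
Proof.
move=> key_inj i j eq_ij; apply: key_inj; case: (ltgtP (key i) (key j)) => //.
- by move/rank_by_lt; rewrite eq_ij ltnn.
- by move/rank_by_lt; rewrite eq_ij ltnn.
Qed.

End RankBy.

(** A path starting in [S] never leaves it. This allows comparing reachability before and after a
    misreport, which may change the revealed relation outside [S]. *)
Lemma connect_eq_in (T : finType) (S : pred T) (e e' : rel T) (x : T) :
    (forall y z, S y -> e y z -> S z) -> (forall y z, S y -> e y z = e' y z) ->
  S x -> connect e x =1 connect e' x.
Proof.
move=> eS ee' Sx y.
have path_eq p : path e x p = path e' x p.
  elim: p x Sx => //= z p IHp x Sx; rewrite -ee' //.
  by case exz: (e x z) => //=; apply: IHp; apply: eS exz.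
by apply/connectP/connectP => -[p pp ->]; exists p; rewrite ?path_eq // -path_eq.
Qed.

Section Mechanism.
Context {n : nat} {g : rel 'I_n}.
Implicit Types (A B : {set 'I_n}) (T : profile g).

Lemma report_eq1 {i} (r : report g i) j k :
  val r j k = 1%R -> observes g i j k /\ comparison_network g j k.
Proof.
move=> rjk; have /forallP/(_ j)/forallP/(_ k)/and3P[_ _] := valP r.
by rewrite rjk oner_neq0 => /esym obs_cmp; apply/andP.
Qed.

Section Bipartite.
Context {A B : {set 'I_n}}.
Context (gAB : bipartite g A B).

Lemma bipartite_side {i j} : g i j -> (j \in A) = (i \notin A).
Proof.
case: gAB => _ dAB /[apply].
by case/orP=> /andP[i_in j_in]; rewrite ?i_in ?j_in ?(disjointFl dAB).
Qed.

Lemma comparison_network_side {i j} :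
  comparison_network g i j -> (i \in A) = (j \in A).
Proof.
case/andP=> _ /existsP[k /andP[/bipartite_side ik /bipartite_side jk]].
by apply: negb_inj; rewrite -ik jk.
Qed.

(** Distinct [i] and [j] are not both [k], so one of them is a friend of [k] and lies opposite; a
    common friend puts [i] and [j] on the same side. *)
Lemma reporter_side {k} (r : report g k) i j :
  val r i j = 1%R -> (i \in A) = (k \notin A).
Proof.
case/report_eq1=> /and3P[ij ki kj] /comparison_network_side eq_ij.
case/orP: ki => [/eqP ik|/bipartite_side //].
case/orP: kj => [/eqP jk|/bipartite_side <- //].
by rewrite ik jk eqxx in ij.
Qed.

Lemma revealed_side {T i j} : revealed T i j -> (i \in A) = (j \in A).
Proof. by case/existsP=> k /eqP/report_eq1[_ /comparison_network_side]. Qed.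

Lemma revealed_dfwith {T i} (r : report g i) {j} k :
  (j \in A) = (i \in A) -> revealed (dfwith T r) j k = revealed T j k.
Proof.
move=> ji; apply: eq_existsb => l.
have [eq_li | ne_li] := eqVneq i l; last by rewrite dfwith_out.
(* Quantifying over [s] covers both the original report and its replacement. *)
have other_side (s : report g l) : (val s j k == 1%R) = false.
  by apply/eqP => /reporter_side; rewrite ji eq_li; case: (l \in A).
by rewrite !other_side.
Qed.

End Bipartite.

Definition score T i : nat := #|connect (revealed T) i|.

Lemma score_dfwith {A B T i} (r : report g i) {j} : bipartite g A B ->
  (j \in A) = (i \in A) -> score (dfwith T r) j = score T j.
Proof.
move=> gAB ji; apply: eq_card.
apply: (@connect_eq_in _ (fun k => (k \in A) == (i \in A))); last exact/eqP.
- by move=> k l /eqP <- /(revealed_side gAB) ->.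
- by move=> k l /eqP; apply: (revealed_dfwith gAB r).
Qed.

Section Generated.
Context {R : realType} {theta : 'I_n -> R} {T : profile g}.
Context (gen : generated_by theta T).

Lemma revealed_lt {i j} : revealed T i j -> (theta j < theta i)%R.
Proof.
case/existsP=> k /eqP; rewrite gen !mxE.
case: ifP => // _; case: ifP => // _ sgz1.
by rewrite -subr_gt0 -sgz_gt0 sgz1.
Qed.

Lemma connect_revealed_le {i j} : connect (revealed T) i j -> (theta j <= theta i)%R.
Proof.
case/connectP=> p; elim: p i => /= [i _ -> // | k p IHp i /andP[ik kp] ej].
exact: le_trans (IHp k kp ej) (ltW (revealed_lt ik)).
Qed.

Lemma score_lt {i j} : succ T i j -> (score T j < score T i)%N.
Proof.
case=> -[[] // | k p [_ /= /andP[ik kp] lastj]].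
have kj : connect (revealed T) k j by apply/connectP; exists p.
have ij := connect_trans (connect1 ik) kj.
have j_lt_i := le_lt_trans (connect_revealed_le kj) (revealed_lt ik).
apply/proper_card/properP; split.
  by apply/subsetP=> l; apply: connect_trans.
(* The inclusion is strict at [i] itself: [theta] never increases along revealed comparisons, so [j]
   cannot reach [i]. *)
exists i; first exact: connect0.
by apply: contraL j_lt_i; rewrite -leNgt; apply: connect_revealed_le.
Qed.

End Generated.

(** The order is lexicographic, with [A] on top. The final [i] breaks ties, so ranks form a
    permutation even for profiles that no realization generates. *)
Definition priority A T i : bool *l (nat *l 'I_n) := (i \in A, (score T i, i)).

Lemma priority_inj A T : injective (priority A T).
Proof. by move=> i j []. Qed.

Definition side_mechanism A : mechanism g :=
  fun T => perm (rank_by_inj (priority A T) (@priority_inj A T)).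

Lemma side_mechanism_dfwith {A B T i} (r : report g i) : bipartite g A B ->
  side_mechanism A (dfwith T r) i = side_mechanism A T i.
Proof.
move=> gAB; rewrite !permE; apply: val_inj; apply: eq_card => j; rewrite !inE.
rewrite /priority !ltxi_pair (score_dfwith r gAB (erefl (i \in A))).
(* On the side of [i] scores are unchanged; across sides the first coordinate decides, whatever the
   scores. *)
have [ji | ] := eqVneq (j \in A) (i \in A); first by rewrite (score_dfwith r gAB ji).
by case: (j \in A) (i \in A) => -[].
Qed.

End Mechanism.

Theorem proposition2 (R : realType) (n : nat) (g : rel 'I_n) (A B : {set 'I_n})
  (g_simple : simple_graph g)
  (g_connected : connected_graph g)
  (A_nonempty : A != set0)
  (B_nonempty : B != set0)
  (g_bipartite : bipartite g A B) :
  exists rho : mechanism g, supports_comparison_network R rho.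
Proof.
exists (side_mechanism A); split.
  (* Incentive compatibility holds with equality, at every profile. *)
  by move=> i T r _; rewrite (side_mechanism_dfwith _ g_bipartite).
move=> T i j [theta _ gen] hij /(score_lt gen) ji; rewrite !permE; apply: rank_by_lt.
rewrite /priority !ltxi_pair (comparison_network_side g_bipartite hij) lexx /=.
by rewrite !leEnat (ltnW ji) leqNgt ji.
Qed.
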